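(* Let $S$ be a semigroup. The following statements are equivalent: 1. $S$ is a semilattice $Y$ of semigroups $S_\alpha$ ($\alpha \in Y$) with $S_\alpha \in RB \cup G_2$ for every $\alpha\in Y$; 2. for all $x,y\in S$, $xyx \in \{xy^2x,\; y^2x^2y\}$ and $x = x^3$.
   Context: A semilattice is a semigroup satisfying $x=x^2$ and $xy=yx$. A semigroup $S$ is a semilattice $Y$ of semigroups $S_\alpha$ ($\alpha\in Y$) if $Y$ is a semilattice, $S$ is the disjoint union of the semigroups $S_\alpha$ ($\alpha \in Y$), and $S_\alpha S_\beta\subseteq S_{\alpha\beta}$ for all $\alpha,\beta\in Y$. $RB$ denotes the collection of all rectangular bands (semigroups satisfying $x=x^2$ and $xyx=x$). $G_2$ denotes the collection of all groups of order two.
   Formalization: ''Groups of order two'' is read as nontrivial groups in which every non-identity element has order two (exponent two), since with groups of exactly two elements the Klein four-group satisfies statement 2 but not statement 1. *)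

(* Defs.v *)
From mathcomp Require Import all_boot.
From mathcomp Require Import boolp classical_sets.

Set Implicit Arguments.
Unset Strict Implicit.
Unset Printing Implicit Defensive.

Local Open Scope classical_set_scope.
Local Open Scope group_scope.

Definition semilattice (Y : semigroupType) : Prop :=
  (forall x : Y, x = x * x) /\ (forall x y : Y, x * y = y * x).

Definition subsemigroup (S : semigroupType) (A : set S) : Prop :=
  forall x y, A x -> A y -> A (x * y).

(* S is the disjoint union of the nonempty sets C a, a : Y; each C a is a
   subsemigroup because a * a = a. *)
Definition semilattice_of_semigroups
    (S Y : semigroupType) (C : Y -> set S) : Prop :=
  [/\ semilattice Y,
      partition [set: Y] C [set: S],
      (forall a, subsemigroup (C a)) &
      (forall a b, [set x * y | x in C a & y in C b] `<=` C (a * b))].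

Definition rectangular_band (S : semigroupType) (A : set S) : Prop :=
  [/\ subsemigroup A,
      (forall x, A x -> x = x * x) &
      (forall x y, A x -> A y -> x * y * x = x)].

Definition subgroup_with_identity
    (S : semigroupType) (A : set S) (e : S) : Prop :=
  [/\ subsemigroup A,
      A e,
      (forall x, A x -> e * x = x /\ x * e = x) &
      (forall x, A x -> exists2 y, A y & x * y = e /\ y * x = e)].

(* The class G_2, "groups of order two": the nontrivial groups in which every
   non-identity element has order two, i.e. the groups of exponent two.
   Cardinality two would be too restrictive: the Klein four-group satisfies
   x = x^3 and xyx = y^2x^2y, but a group is a semilattice of subsemigroups
   only in the trivial way, with a single component. *)
Definition group_of_exponent_two (S : semigroupType) (A : set S) : Prop :=
  exists e, [/\ subgroup_with_identity A e,
                (exists2 x, A x & x <> e) &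
                (forall x, A x -> x * x = e)].

(* Main.v *)
Require Import Defs.
From HB Require Import structures.
From mathcomp Require Import all_boot generic_quotient.
From mathcomp Require Import boolp classical_sets.

Local Open Scope classical_set_scope.
Local Open Scope group_scope.

(** If [x = x^3] holds in [S], then [S] is a semilattice of its J-classes, each
of which is completely simple and satisfies [(xyx)^2 = x^2]. When a J-class
contains an element [x] with [e = x^2 <> x], the disjunction applied to the
pair [(f, x)] forces every idempotent [f] of the J-class to be [e], so the
J-class is a group of exponent two; otherwise all its elements are idempotent
and it is a rectangular band. Conversely, [xyx], [xy^2x] and [y^2x^2y] all lie
in the component of [xy], and the two alternatives correspond to the two kinds
of component. *)

(** To be applied to J-equivalence, giving the index semilattice; classes are multiplied through
    chosen representatives. *)
Lemma quotient_semigroup (S : semigroupType) (r : S -> S -> Prop) :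
  (forall x, r x x) -> (forall x y, r x y -> r y x) ->
  (forall x y z, r x y -> r y z -> r x z) ->
  (forall x x' y y', r x x' -> r y y' -> r (x * y) (x' * y')) ->
  exists (Y : semigroupType) (p : S -> Y),
    [/\ forall x y, p (x * y) = p x * p y,
        forall a, exists x, p x = a &
        forall x y, p x = p y <-> r x y].
Proof.
move=> r_refl r_sym r_trans r_mul.
pose b x y := `[< r x y >].
have b_refl : reflexive b by move=> x; apply/asboolP.
have b_sym : symmetric b.
  by move=> x y; apply/asboolP/asboolP => /r_sym.
have b_trans : transitive b.
  by move=> y x z /asboolP xy /asboolP yz; apply/asboolP; exact: r_trans xy yz.
pose Q := {eq_quot EquivRel b b_refl b_sym b_trans}%qT.
pose p (x : S) : Q := (\pi_Q x)%qT.
have pE x y : p x = p y <-> r x y.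
  split=> [/eqmodP/asboolP //|xy]; exact/eqmodP/asboolP.
have pK (a : Q) : p (repr a) = a by exact: reprK.
pose m (a c : Q) : Q := p (repr a * repr c).
have pM x y : p (x * y) = m (p x) (p y).
  by apply/pE/r_mul; apply/pE; rewrite pK.
have mA : associative m.
  by move=> a c d; rewrite -[a]pK -[c]pK -[d]pK -!pM mulgA.
pose Y : semigroupType := HB.pack Q (isSemigroup.Build Q mA).
exists Y, p; split=> // a.
by exists (repr a); exact: pK.
Qed.

Section JOrder.

Variable S : semigroupType.
Implicit Types x y z : S.

(** Green's J-preorder; [S x S] may replace [S^1 x S^1] because [x = x^3]. *)
Definition jle x y := exists p q, x = p * y * q.

Definition jequiv x y := jle x y /\ jle y x.

Hypothesis cube : forall x, x = x * x * x.

Lemma jle_refl x : jle x x.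
Proof. by exists x, x. Qed.

Lemma jle_trans x y z : jle x y -> jle y z -> jle x z.
Proof.
by move=> [p [q ->]] [r [s ->]]; exists (p * r), (s * q); rewrite !mulgA.
Qed.

Lemma jle_mulr x y : jle (x * y) x.
Proof. by exists x, (x * y); rewrite !mulgA -cube. Qed.

Lemma jle_mull x y : jle (x * y) y.
Proof. by exists (x * y), y; rewrite -!mulgA [y * (y * y)]mulgA -cube. Qed.

(** The cube of [x * y] contains [y * x] as a factor. *)
Lemma jle_mulC x y : jle (x * y) (y * x).
Proof. by exists x, (y * x * y); rewrite {1}[x * y]cube !mulgA. Qed.

(** Makes [x * y] a greatest lower bound of [x] and [y], whence J-equivalence is a congruence.
    Multiplying the two factorisations of [z] puts [y] before [x] in [z * z]; [jle_mulC] then swaps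
    them. *)
Lemma jle_mul z x y : jle z x -> jle z y -> jle z (x * y).
Proof.
move=> [p [q zx]] [r [s zy]].
have z_zz : jle z (z * z) by rewrite {1}[z]cube; apply: jle_mulr.
apply: jle_trans z_zz _.
have zz : z * z = r * (y * (s * p * x)) * q.
  by rewrite {1}zy zx !mulgA.
apply: (@jle_trans _ (y * (s * p * x))); first by exists r, q.
rewrite mulgA; apply: jle_trans (jle_mulC _ _) _.
by rewrite !mulgA -[X in jle X _]mulgA; apply: jle_mulr.
Qed.

Lemma jequiv_refl x : jequiv x x.
Proof. by split; apply: jle_refl. Qed.

Lemma jequiv_sym x y : jequiv x y -> jequiv y x.
Proof. by case. Qed.

Lemma jequiv_trans x y z : jequiv x y -> jequiv y z -> jequiv x z.
Proof.
by move=> [xy yx] [yz zy]; split; [apply: jle_trans yz|apply: jle_trans yx].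
Qed.

Lemma jequiv_mul x x' y y' :
  jequiv x x' -> jequiv y y' -> jequiv (x * y) (x' * y').
Proof.
move=> [xx' x'x] [yy' y'y]; split; apply: jle_mul.
- exact: jle_trans (jle_mulr _ _) xx'.
- exact: jle_trans (jle_mull _ _) yy'.
- exact: jle_trans (jle_mulr _ _) x'x.
- exact: jle_trans (jle_mull _ _) y'y.
Qed.

Lemma jequiv_mulC x y : jequiv (x * y) (y * x).
Proof. by split; apply: jle_mulC. Qed.

Lemma jequiv_sqr x : jequiv x (x * x).
Proof. by split; [apply: jle_mul; apply: jle_refl|apply: jle_mulr]. Qed.

Lemma sqr_idem x : x * x * (x * x) = x * x.
Proof. by rewrite !mulgA -cube. Qed.

(** [x] is J-equivalent to [u = xyx]; by stability of the J-classes [x] then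
lies in [uS], so the idempotent [u^2] is a left identity of [x]. *)
Lemma sqr_sandwich x y : jle x y -> x * y * x * (x * y * x) = x * x.
Proof.
move=> xy.
have cubeA z : z * (z * z) = z by rewrite mulgA -cube.
have : jle x (x * y * x).
  by apply: jle_mul; [apply: jle_mul|]; first [exact: xy|exact: jle_refl].
move uE: (x * y * x) => u [p [q xE]].
have uxx : u * x * x = u by rewrite -uE -!mulgA cubeA.
have [w wE] : exists w, w = y * x * q by eexists.
have xw : x = p * x * w by rewrite wE {1}xE -uE !mulgA.
(* Iterating [x = p * x * w] three times allows [w * w] to be absorbed on the right, by [cube] for
   [w]. Then [x = x * w * w] starts with [x * y * x], because [w] starts with [y * x]. *)
have xp3 : x = p * p * p * x * (w * w * w).
  by rewrite {1}xw {1}xw {1}xw !mulgA.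
have xww : x = x * w * w by rewrite {1}xp3 {2}xp3 -!mulgA !cubeA.
have xu : x = u * (q * w) by rewrite {1}xww -uE {1}wE !mulgA.
have uux : u * u * x = x by rewrite [in LHS]xu [in RHS]xu !mulgA -cube.
by rewrite -{2}uxx !mulgA uux.
Qed.

Hypothesis sandwich : forall x y,
  x * y * x = x * (y * y) * x \/ x * y * x = (y * y) * (x * x) * y.

Lemma jequiv_idem_eq_sqr x f :
  x * x <> x -> f * f = f -> jequiv x f -> f = x * x.
Proof.
move=> x_nidem ff [xf fx].
have xx_f : jle (x * x) f by apply: jle_trans xf; apply: jle_mulr.
have f_xx : jle f (x * x) by apply: jle_mul.
have xe : x * (x * x) = x by rewrite mulgA -cube.
move: x_nidem xx_f f_xx (sqr_idem x) (cube x) xe (sqr_sandwich _ _ xf).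
move eE: (x * x) => e x_nidem xx_f f_xx ee /esym ex xe xfx2.
have efe2 : e * f * e * (e * f * e) = e by rewrite sqr_sandwich.
have fef2 : f * e * f * (f * e * f) = f by rewrite sqr_sandwich.
case: (sandwich f x) => fxf; rewrite ?ff eE in fxf.
(* Here [f * x * f = f * e * f], so [e * f * x * f * e] is the square of [e * f * e], that is [e].
   Computed from the sandwich of [f * x] by [x], the same word equals [x]. *)
- case: x_nidem.
  have efxfe : e * f * x * f * e = e.
    rewrite -(mulgA e f x) -(mulgA e (f * x)) fxf.
    by rewrite -[RHS]efe2 !mulgA -(mulgA _ e e) ee.
  have : x * (f * x) * x * (x * (f * x) * x) = e.
    by rewrite -eE; apply: sqr_sandwich; apply: jle_mul => //; apply: jle_refl.
  rewrite !mulgA -(mulgA _ x x) eE -(mulgA _ x x) eE -(mulgA _ x e) xe.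
  by move/(congr1 (mul x)); rewrite xe !mulgA eE efxfe.
(* Here [f * x * f = e * f * x], a word fixed by [f] on both sides. Hence [f] also fixes [e] on both
   sides, and [fef2] collapses to [f = e]. *)
- have fe : f * e = e.
    have : f * (e * f * x) * x = e * f * x * x by rewrite -fxf !mulgA ff.
    rewrite -(mulgA f) -(mulgA (e * f)) eE => fefe.
    by rewrite -[e in LHS]efe2 mulgA fefe efe2.
  have ef : e * f = e.
    have : e * f * x * f = e * f * x by rewrite -fxf -mulgA ff.
    move/(congr1 (mul x)); rewrite !mulgA xe => xfxf.
    by rewrite -{1}xfx2 -mulgA xfxf.
  by rewrite -fef2 -(mulgA f e f) ef fe ee.
Qed.

Lemma jclass_RB_or_G2 z :
  rectangular_band [set x | jequiv z x] \/
  group_of_exponent_two [set x | jequiv z x].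
Proof.
set A := [set x | _].
have A_eq x y : A x -> A y -> jequiv x y.
  by move=> /jequiv_sym; apply: jequiv_trans.
have A_mul : subsemigroup A.
  move=> x y Ax Ay; apply: jequiv_trans (jequiv_sqr _) _.
  exact: jequiv_mul.
have [[x [Ax x_nidem]]|A_idem] := pselect (exists x, A x /\ x * x <> x).
- right; exists (x * x).
  (* [y * y] is an idempotent of the class, so it must be [x * x]; each element is thus its own
     inverse. *)
  have A_sqr y : A y -> y * y = x * x.
    move=> Ay; apply: jequiv_idem_eq_sqr => //; first exact: sqr_idem.
    exact: A_eq (A_mul _ _ Ay Ay).
  split=> //; last by exists x => // /esym.
  split=> // [|y Ay|y Ay]; first exact: A_mul.
  + by rewrite -(A_sqr y) // mulgA -cube.
  + by exists y => //; rewrite A_sqr.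
- left.
  have idem x : A x -> x * x = x.
    by move=> Ax; apply: contrapT => ?; apply: A_idem; exists x.
  split=> // [x /idem //|x y Ax Ay].
  have [xy _] := A_eq _ _ Ax Ay.
  have Axyx : A (x * y * x) by do 2?apply: (A_mul).
  by rewrite -[LHS]idem // sqr_sandwich // idem.
Qed.

End JOrder.

Lemma rectangular_band_sandwich (S : semigroupType) (A : set S) (x y : S) :
  rectangular_band A -> A (x * y) -> A (y * x) -> A (x * y * x) ->
  x * y * x = x * (y * y) * x.
Proof.
move=> [A_mul A_idem A_rect] Axy Ayx Axyx.
have drop_mid u v w : A u -> A v -> A w -> u * v * w = u * w.
  move=> Au Av Aw; rewrite -{1}(A_rect w u) // !mulgA -(mulgA u v w).
  by rewrite A_rect //; apply: A_mul.
have idem : x * y * x * y = x * y by rewrite -mulgA -A_idem.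
rewrite !mulgA -[RHS]mulgA -(drop_mid _ (x * y * x) (y * x)) // !mulgA.
by rewrite !idem.
Qed.

(** Next to elements of [A], [x] and [y] act as the group elements [e * x] and [e * y]. After this
    replacement both sides reduce to [t]. *)
Lemma group_of_exponent_two_sandwich (S : semigroupType) (A : set S) (x y : S) :
  group_of_exponent_two A ->
  (forall z, A z -> A (z * x)) -> (forall z, A z -> A (z * y)) ->
  A (x * y * x) -> A (y * y * (x * x) * y) ->
  x * y * x = y * y * (x * x) * y.
Proof.
move=> [e [[A_mul Ae Aunit _] _ Asqr]] Ax Ay Axyx Ayxy.
have unit_l z : A z -> e * z = z by case/Aunit.
have unit_r z : A z -> z * e = z by case/Aunit.
have AS z w : A z -> A w -> A (z * w) by move=> ? ?; apply: A_mul.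
pose s := e * x; pose t := e * y.
have [As At] : A s /\ A t by split; [apply: Ax|apply: Ay].
have -> : x * y * x = s * t * s.
  by rewrite -[LHS]unit_l // /s /t !mulgA !unit_r //; do ?[apply: Ax|apply: Ay].
have -> : y * y * (x * x) * y = t * t * (s * s) * t.
  rewrite -[LHS]unit_l // /s /t !mulgA !unit_r //;
  by do ?[exact: Ae|apply: (Ax)|apply: (Ay)].
rewrite !Asqr // unit_l //.
have stst : s * t * s * t = e by rewrite -mulgA Asqr //; apply: AS.
have Asts : A (s * t * s) by apply: (AS) => //; apply: AS.
by rewrite -(unit_r _ Asts) -(Asqr t) // mulgA stst unit_l.
Qed.

Theorem theorem5 (S : semigroupType) :
  (exists (Y : semigroupType) (C : Y -> set S),
      semilattice_of_semigroups C /\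
      (forall a : Y, rectangular_band (C a) \/ group_of_exponent_two (C a)))
  <->
  ((forall x y : S,
      x * y * x = x * (y * y) * x \/ x * y * x = (y * y) * (x * x) * y) /\
   (forall x : S, x = x * x * x)).
Proof.
split=> [[Y [C [[[Yidem Ycomm] [cov _ _] _ C_mul] C_RB_G2]]]|[sandwich cube]].
- have C_ex x : exists a, C a x.
    have [a _ Cx] : (\bigcup_(a in setT) C a) x by rewrite -[bigcup _ _]/(cover setT C) cov.
    by exists a.
  have CM a b x y : C a x -> C b y -> C (a * b) (x * y).
    by move=> Cx Cy; apply: C_mul; exists x => //; exists y.
  split=> [x y|x].
  + have [[a Cx] [b Cy]] := (C_ex x, C_ex y).
    have aab : a * b * a = a * b by rewrite Ycomm mulgA -Yidem.
    have abb : a * b * b = a * b by rewrite -mulgA -Yidem.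
    have Cxyx : C (a * b) (x * y * x) by rewrite -aab; apply: (CM) => //; apply: CM.
    (* Every word involving both [x] and [y] lies in [C (a * b)], so the type of this one component
       selects the alternative. *)
    case: (C_RB_G2 (a * b)) => [RB|G2]; [left|right].
    * apply: rectangular_band_sandwich RB _ _ _ => //; first exact: CM.
      by rewrite Ycomm; exact: CM.
    * apply: group_of_exponent_two_sandwich G2 _ _ _ _ => //.
      - by move=> z Cz; rewrite -aab; exact: CM.
      - by move=> z Cz; rewrite -abb; exact: CM.
      - have -> : a * b = b * b * (a * a) * b.
          by rewrite -!Yidem -(Ycomm a) abb.
        by apply: (CM) => //; apply: (CM); apply: CM.
  + have [a Cx] := C_ex x.
    case: (C_RB_G2 a) => [[_ idem _]|[e [[_ _ unit _] _ sqr]]].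
      by rewrite -!idem.
    by rewrite sqr //; case: (unit x Cx).
(* The components are the fibres of the projection onto the J-classes. *)
- have [Y [p [pM p_surj pE]]] := quotient_semigroup S (jequiv S)
    (jequiv_refl S cube) (@jequiv_sym S) (@jequiv_trans S) (jequiv_mul S cube).
  exists Y, (fun a => [set x | p x = a]); split; last first.
    move=> a; have [z <-] := p_surj a.
    have -> : [set x | p x = p z] = [set x | jequiv S z x].
      by apply/seteqP; split=> x /= => [/esym/pE|/pE/esym].
    exact: jclass_RB_or_G2.
  have Y_idem (a : Y) : a = a * a.
    by have [x <-] := p_surj a; rewrite -pM; apply/pE/jequiv_sqr.
  split.
  + split=> // a b; have [[x <-] [y <-]] := (p_surj a, p_surj b).
    by rewrite -!pM; apply/pE/jequiv_mulC.
  + split=> [|a b _ _ [x [/= <- <-]] //|a _].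
      by apply/seteqP; split=> // x _; exists (p x).
    by have [x px] := p_surj a; exists x.
  + by move=> a x y /= px py; rewrite pM px py -Y_idem.
  + by move=> a b _ [x /= px [y /= py <-]]; rewrite pM px py.
Qed.
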